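(* Let $k>0$ and $m>0$ be integers and let $G=\overline{k}\,|m|\,\overline{1}$ (the component consisting, from left to right, of $k$ bulbs, then $m$ sockets, then $1$ bulb). Then $$\mathcal{G}(G)=\begin{cases} \infty & \text{if } m=1,\\ k & \text{if } m>1 \text{ is odd},\\ k+1 & \text{if } m \text{ is even}.\end{cases}$$
   Context: The ruleset CHRISTMAS LIGHTS' FIXTURE. A component is a finite (possibly empty) word, read from left to right, in two kinds of pieces: bulbs and sockets. The ruleset is impartial; the moves available in a component are: (1) choose a bulb: that bulb and every piece to its right are deleted (a quiet move); (2) choose a socket that does not have bulbs as both its left and right neighbours (either neighbour is a socket or does not exist): only that socket is deleted and the two ends are joined (a quiet move); (3) choose a socket whose left and right neighbours both exist and are bulbs: only that socket is deleted, the two ends are joined, and the same player must move again, in any component of the current disjunctive sum (a carry-on move). A player who has to move and has no move loses (normal play). A disjunctive sum of components (and nim heaps) is played by moving in exactly one summand at each move, with players alternating except for carry-on moves. A $\mathcal P$-position is one that the previous player (the one not about to move) wins; an $\mathcal N$-position is one that the next player wins. Grundy-value. $\mathcal{G}(G)\in\{0,1,2,\dots\}\cup\{\infty\}$ is defined recursively. Let $S_G$ be the set of all finite Grundy-values of components reachable from $G$ by one quiet move. Let $P_G$ be the set of nonnegative integers $j$ such that some carry-on move leads from $G$ to a component $G'$ with $\mathcal{G}(G')\neq j$ (so $\mathcal G(G')=\infty$ protects every $j$). Then $\mathcal{G}(G)=\operatorname{mex}(S_G\cup P_G)$, the least nonnegative integer not in $S_G\cup P_G$, and $\mathcal{G}(G)=\infty$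 if $S_G\cup P_G$ contains all nonnegative integers. Equivalently, $\mathcal{G}(G)=n<\infty$ iff the sum of $G$ and a nim heap $*n$ of size $n$ is a $\mathcal P$-position, and $\mathcal{G}(G)=\infty$ iff there is no such $n$. Notation: $\overline{n}$ is a string of $n$ consecutive bulbs, $|m|$ is a string of $m$ consecutive sockets, and juxtaposition is concatenation from left to right. *)

(* Defs.v *)
From mathcomp Require Import all_boot.
From mathcomp Require Import boolp classical_sets.

Set Implicit Arguments.
Unset Strict Implicit.
Unset Printing Implicit Defensive.

Local Open Scope classical_set_scope.

Inductive piece := Bulb | Socket.

Definition component := seq piece.

Definition bulbs (n : nat) : component := nseq n Bulb.
Definition sockets (m : nat) : component := nseq m Socket.

(* The piece sitting between the words [u] and [v] has two neighbours, both
   bulbs; [ohead] is [None] when the neighbour does not exist. *)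
Definition between_bulbs (u v : component) : Prop :=
  ohead (rev u) = Some Bulb /\ ohead v = Some Bulb.

Inductive quiet_move : component -> component -> Prop :=
| QuietBulb u v : quiet_move (u ++ Bulb :: v) u
| QuietSocket u v : ~ between_bulbs u v ->
    quiet_move (u ++ Socket :: v) (u ++ v).

Inductive carry_on_move : component -> component -> Prop :=
| CarryOnSocket u v : between_bulbs u v ->
    carry_on_move (u ++ Socket :: v) (u ++ v).

(* Values in nat + {oo} are encoded in [option nat], with [None] for oo. *)
Definition mex (A : set nat) : option nat :=
  if pselect (exists n, `[< ~ A n >]) is left ex then Some (ex_minn ex)
  else None.

Lemma mex_SomeP (A : set nat) n :
  mex A = Some n <-> ~ A n /\ forall j, j < n -> A j.
Proof.
rewrite /mex; case: pselect => [ex|nex]; last first.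
  by split=> // -[An _]; case: nex; exists n; apply/asboolP.
case: ex_minnP => p /asboolP Ap pmin; split=> [[<-]|[An ltA]].
  split=> // j jp; apply: contrapT => Aj.
  by have := pmin j; rewrite leqNgt jp /=; move=> h; have := h (asboolT Aj).
congr Some; apply/eqP; rewrite eqn_leq pmin ?asboolT //= leqNgt.
by apply/negP => /ltA.
Qed.

Lemma mex_NoneP (A : set nat) : mex A = None <-> forall j, A j.
Proof.
rewrite /mex; case: pselect => [ex|nex]; split=> //.
- by have [n /asboolP An] := ex => /(_ n).
- by move=> _ j; apply: contrapT => Aj; apply: nex; exists j; apply/asboolP.
Qed.

(* [SG g G] and [PG g G] are the sets S_G and P_G computed from values [g] of
   the options of [G]. *)
Definition SG (g : component -> option nat) (G : component) : set nat :=
  [set j | exists2 H, quiet_move G H & g H = Some j].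

Definition PG (g : component -> option nat) (G : component) : set nat :=
  [set j | exists2 H, carry_on_move G H & g H <> Some j].

Definition grundy_step (g : component -> option nat) (G : component) :
    option nat := mex (SG g G `|` PG g G).

(* Every move shortens the word, so [size G + 1] rounds of the recursion
   determine the value at [G]; the starting function is irrelevant. The
   intended recursive equation is [grundyE]. *)
Definition grundy (G : component) : option nat :=
  iter (size G).+1 grundy_step (fun=> None) G.

Lemma quiet_move_size G H : quiet_move G H -> size H < size G.
Proof.
by case=> [u v|u v _]; rewrite !size_cat /= addnS ltnS ?leq_addr.
Qed.

Lemma carry_on_move_size G H : carry_on_move G H -> size H < size G.
Proof. by case=> u v _; rewrite !size_cat /= addnS. Qed.

Lemma grundy_step_ext g h G : (forall H, size H < size G -> g H = h H) ->
  grundy_step g G = grundy_step h G.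
Proof.
move=> gh; rewrite /grundy_step; congr (mex (_ `|` _)); apply/seteqP.
- split=> j [H GH gj]; exists H => //; have /gh ghH := quiet_move_size GH;
  by move: gj; rewrite ghH.
- split=> j [H GH gj]; exists H => //; have /gh ghH := carry_on_move_size GH;
  by move: gj; rewrite ghH.
Qed.

Lemma grundyE G : grundy G = mex (SG grundy G `|` PG grundy G).
Proof.
have stable n p H : size H < n -> size H < p ->
    iter n grundy_step (fun=> None) H = iter p grundy_step (fun=> None) H.
  elim: n p H => // n IHn [//|p] H Hn Hp /=.
  by apply: grundy_step_ext => K KH; apply: IHn; apply: leq_trans KH _.
rewrite {1}/grundy /=; apply: grundy_step_ext => H HG.
exact: stable.
Qed.

(* Main.v *)
Require Import Defs.
From mathcomp Require Import all_boot.

(* A string of one or more sockets contains no socket flanked by two bulbs,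
   unless it is a single socket with bulbs on both sides. So the only carry-on
   move met here is [k |1| 1 -> k+1 bulbs], which covers every value but [k+1];
   the quiet move to [k |1|], of value [k+1], covers that one and makes the
   value infinite. For [m > 1] the options have values [0, ..., k-1], that of
   [k |m|] and that of [k |m-1| 1], and the parity pattern follows by induction
   on [m]. *)

(** Locates the piece [y] chosen by a move: inside the leading run or beyond it. One application per
    run finds it in a word made of several runs. *)
Lemma nseq_cat_eq_cat {T : Type} {n} {x y : T} {s u v} :
  nseq n x ++ s = u ++ y :: v ->
  (exists2 i, i < n &
     [/\ u = nseq i x, y = x & v = nseq (n - i.+1) x ++ s]) \/
  (exists2 u', u = nseq n x ++ u' & s = u' ++ y :: v).
Proof.
elim: n u => [|n IHn] u /=; first by right; exists u.
case: u => [|z u] /= [<-].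
  by move=> <-; left; exists 0; rewrite // subSS subn0.
case/IHn => [[i ltin [-> -> ->]]|[u' -> ->]]; last by right; exists u'.
by left; exists i.+1; rewrite // subSS.
Qed.

(** Any of [k], [m], [e] may be 0, so this also serves words without sockets or without right
    bulbs. *)
Lemma quiet_move_inv k m e H :
  quiet_move (bulbs k ++ sockets m ++ bulbs e) H ->
  [\/ exists2 i, i < k & H = bulbs i,
      exists2 m', m = m'.+1 & H = bulbs k ++ sockets m' ++ bulbs e |
      exists2 i, i < e & H = bulbs k ++ sockets m ++ bulbs i].
Proof.
move GE: (bulbs k ++ _) => G GH.
case: GH GE => [u v|u v _]; case/nseq_cat_eq_cat => [[i ltik [-> // _ _]]|[w ->]].
- by constructor 1; exists i.
- case/nseq_cat_eq_cat => [[i _ [_ //]]|[w' ->]].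
  rewrite -[bulbs e]cats0 => /nseq_cat_eq_cat [[i ltie [-> _ _]]|[[] //]].
  by constructor 3; exists i.
- case/nseq_cat_eq_cat => [[i ltim [-> _ ->]]|[w' ->]].
    (* The [i] sockets before the deleted one and the [m - i.+1] after it join into one run. *)
    constructor 2; exists m.-1; first by rewrite prednK // (leq_ltn_trans _ ltim).
    rewrite -catA; congr (_ ++ _); rewrite catA -nseqD; congr (nseq _ _ ++ _).
    by rewrite subnS -subn1 -subn1 addnBA ?subn_gt0 // subnKC // ltnW.
  by rewrite -[bulbs e]cats0 => /nseq_cat_eq_cat [[i _ [_ //]]|[[] //]].
Qed.

Lemma carry_on_move_inv k m e H :
  carry_on_move (bulbs k ++ sockets m ++ bulbs e) H -> m = 1 /\ 0 < e.
Proof.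
move GE: (bulbs k ++ _) => G GH.
case: GH GE => u v [uB vB]; case/nseq_cat_eq_cat => [[i _ [_ //]]|[w uE]].
case/nseq_cat_eq_cat => [[i ltim [wE _ vE]]|[w' _]]; last first.
  by rewrite -[bulbs e]cats0 => /nseq_cat_eq_cat [[i _ [_ //]]|[[] //]].
move: uB vB; rewrite {}uE {}wE {}vE rev_cat rev_nseq.
(* A left neighbour that is a bulb forces [i = 0]; a right one then forces [m - 1 = 0] and
   [0 < e]. *)
case: i ltim => // ltim _.
case: (m - 1) (subnK ltim) => //= <-.
by case: e.
Qed.

Lemma quiet_move_left k m e i :
  i < k -> quiet_move (bulbs k ++ sockets m ++ bulbs e) (bulbs i).
Proof.
move=> ltik; rewrite -(subnKC ltik) addSnnS /bulbs nseqD -catA.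
exact: QuietBulb.
Qed.

Lemma quiet_move_right k m :
  quiet_move (bulbs k ++ sockets m ++ bulbs 1) (bulbs k ++ sockets m).
Proof. by rewrite catA; apply: QuietBulb. Qed.

(** The first socket is deleted: its right neighbour is a socket, or is missing when [m = e = 0]. *)
Lemma quiet_move_socket k m e : m != 0 \/ e = 0 ->
  quiet_move (bulbs k ++ sockets m.+1 ++ bulbs e)
             (bulbs k ++ sockets m ++ bulbs e).
Proof.
move=> me; apply: QuietSocket => -[_].
by case: me => [|->]; case: m.
Qed.

Lemma grundy_bulbs k : grundy (bulbs k) = Some k.
Proof.
elim/ltn_ind: k => k IHk; rewrite grundyE; apply/mex_SomeP; split=> [[]|j jk].
- case=> H; rewrite -[bulbs k]cats0 => /(@quiet_move_inv k 0 0).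
  by case=> [[i ik ->]|[]//|[]//]; rewrite IHk // => -[ij]; rewrite ij ltnn in ik.
- by case=> H; rewrite -[bulbs k]cats0 => /(@carry_on_move_inv k 0 0) [].
- left; exists (bulbs j); last exact: IHk.
  by have := @quiet_move_left k 0 0 _ jk; rewrite cats0.
Qed.

Lemma grundy_bulbs_sockets k m :
  grundy (bulbs k ++ sockets m) = Some (k + odd m).
Proof.
elim: m => [|m IHm]; first by rewrite cats0 addn0 grundy_bulbs.
have GE n : bulbs k ++ sockets n = bulbs k ++ sockets n ++ bulbs 0.
  by rewrite cats0.
rewrite grundyE; apply/mex_SomeP; split=> [[]|j jk].
- case=> H; rewrite GE => /quiet_move_inv [[i ik ->]|[_ [<-] ->]|[]//].
    by rewrite grundy_bulbs => -[ij]; rewrite ij ltnNge leq_addr in ik.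
  by rewrite -GE IHm /= => -[/addnI]; case: odd.
- by case=> H; rewrite GE => /carry_on_move_inv [].
- left; have [jltk|kj] := ltnP j k.
    by exists (bulbs j); rewrite ?grundy_bulbs // GE; apply: quiet_move_left.
  exists (bulbs k ++ sockets m).
    by rewrite !GE; apply: quiet_move_socket; right.
  (* Only [j = k] with [m] even remains, and the option then has value [k]. *)
  rewrite IHm; congr Some; move: jk => /=.
  case: (odd m); rewrite /= ?addn0 ?addn1.
    by rewrite ltnNge kj.
  by rewrite ltnS => jk; apply/eqP; rewrite eqn_leq kj.
Qed.

Lemma grundy_bulbs_socket_bulb k : 0 < k ->
  grundy (bulbs k ++ sockets 1 ++ bulbs 1) = None.
Proof.
move=> k_gt0; rewrite grundyE; apply/mex_NoneP => j.
have [->|jk] := eqVneq j k.+1.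
  left; exists (bulbs k ++ sockets 1); first exact: quiet_move_right.
  by rewrite grundy_bulbs_sockets addn1.
right; exists (bulbs k ++ bulbs 1).
  by apply: CarryOnSocket; split=> //; rewrite rev_nseq; case: k k_gt0 {jk}.
rewrite -nseqD -/(bulbs _) grundy_bulbs addn1 => -[kj].
by rewrite kj eqxx in jk.
Qed.

Theorem theorem3 (k m : nat) (k_gt0 : 0 < k) (m_gt0 : 0 < m) :
  grundy (bulbs k ++ sockets m ++ bulbs 1) =
    if m == 1 then None
    else if odd m then Some k
    else Some k.+1.
Proof.
case: m m_gt0 => // m _; elim: m => [|m IHm].
  exact: grundy_bulbs_socket_bulb.
set b := odd m; have oddE : odd m.+2 = b by rewrite /= negbK.
have -> : (if m.+2 == 1 then None else if odd m.+2 then Some k else Some k.+1)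
    = Some (k + ~~ b) by rewrite oddE; case: b {oddE}; rewrite /= ?addn0 ?addn1.
(* With one socket fewer the value is infinite or, by the opposite parity, the other element of
   [{k, k+1}]. *)
have IH : grundy (bulbs k ++ sockets m.+1 ++ bulbs 1) <> Some (k + ~~ b).
  rewrite IHm /= -/b; case: (m.+1 == 1) => //.
  by case: b {oddE} => /= -[]; rewrite ?addn0 ?addn1 => /eqP;
    rewrite ?[k.+1 == k]eq_sym eqn_leq ?ltnn ?andbF.
rewrite grundyE; apply/mex_SomeP; split=> [[]|j jk].
- case=> H /quiet_move_inv [[i ik ->]|[_ [<-] ->] /IH//|[[|//] _ ->]].
    by rewrite grundy_bulbs => -[ij]; rewrite ij ltnNge leq_addr in ik.
  rewrite cats0 grundy_bulbs_sockets oddE => -[/addnI].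
  by case: b {oddE IH}.
- by case=> H /carry_on_move_inv [].
- left; have [jltk|kj] := ltnP j k.
    by exists (bulbs j); rewrite ?grundy_bulbs //; apply: quiet_move_left.
  (* Here [k <= j < k + ~~ b], so [b] is false and [j = k], the value of this option. *)
  exists (bulbs k ++ sockets m.+2); first exact: quiet_move_right.
  rewrite grundy_bulbs_sockets oddE; congr Some.
  case: b {oddE IH} jk => /=; rewrite ?addn0 ?addn1.
    by rewrite ltnNge kj.
  by rewrite ltnS => jk; apply/eqP; rewrite eqn_leq kj.
Qed.
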